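(* Let $(N_k)_{k\ge 1}$ be a sequence of positive integers with $N_k\to\infty$, and let $a,b\in\mathbb{C}$ be fixed (independent of $k$) with $|a|^2+|b|^2=1$. For each $k$ consider the $N_k$-qubit state $$|GHZ_+(a)\rangle = a\,|0\rangle^{\otimes N_k}+b\,|1\rangle^{\otimes N_k}\in(\mathbb{C}^2)^{\otimes N_k}.$$ Then (the sequence of states) $|GHZ_+(a)\rangle$ is convertible by a gSL transformation to (the sequence of product states) $|0\rangle^{\otimes N_k}$.
   Context: Qubit systems: for each size $N_k$ the Hilbert space is $\mathcal{H}=(\mathbb{C}^2)^{\otimes N_k}$, with one tensor factor per qubit and $\{|0\rangle,|1\rangle\}$ the standard orthonormal basis of $\mathbb{C}^2$; the qubits sit on the sites of a graph of fixed finite spatial dimension. A ''state'' $|\Psi\rangle$ means a sequence of nonzero vectors, one for each size $N_k$ ($N_k\to\infty$); the dependence on $N_k$ is suppressed in the notation. Stochastic local (SL) transformations: a layer of piecewise stochastic local transformation with range $l$ is an operator $W_{pwl}=\prod_i W^i$, where the $W^i$ are invertible operators acting on pairwise non-overlapping regions (sets of qubits), each region of size less than $l$, and each $W^i$ satisfies $W^{i\dagger}W^i\le I$. An SL transformation is a product $W^{(1)}_{pwl}W^{(2)}_{pwl}\cdots W^{(M)}_{pwl}$ of finitely many such layers, where the number of layers $M$ and the range $l$ are constants independent of the system size $N_k$. A generalized stochastic local (gSL) transformation is a finite combination of SL transformations and of tensoring with product states, $|\Psi\rangle\mapsto\big(\bigotimes_i|\psi_i\rangle\big)\otimes|\Psi\rangle$,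 where $|\psi_i\rangle$ is a state of the $i$-th added qubit. In particular every SL transformation is a gSL transformation. Convertibility by gSL transformation: $|\Psi\rangle$ is convertible to $|\Phi\rangle$ by a gSL transformation if for every $\epsilon>0$ there exist an integer $N$, a number $0<p<1$, and gSL transformations $W_{N_k}$ such that for every $N_k>N$, $$\left\|\frac{W_{N_k}|\Psi\rangle\langle\Psi|W_{N_k}^\dagger}{\mathrm{Tr}\big(W_{N_k}|\Psi\rangle\langle\Psi|W_{N_k}^\dagger\big)}-\frac{|\Phi\rangle\langle\Phi|}{\mathrm{Tr}(|\Phi\rangle\langle\Phi|)}\right\|_{\mathrm{tr}}<\epsilon \quad\text{and}\quad \frac{\mathrm{Tr}\big(W_{N_k}|\Psi\rangle\langle\Psi|W_{N_k}^\dagger\big)}{\mathrm{Tr}(|\Psi\rangle\langle\Psi|)}>p,$$ where $\|\cdot\|_{\mathrm{tr}}$ is the trace norm. The constants $M$ and $l$ of the transformations $W_{N_k}$ do not depend on $N_k$. *)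

(* Defs.v *)
From HB Require Import structures.
From mathcomp Require Import all_boot all_order all_algebra.
From mathcomp Require Import complex.
From mathcomp Require Import boolp classical_sets reals topology.

Set Implicit Arguments.
Unset Strict Implicit.
Unset Printing Implicit Defensive.

Import Order.TTheory GRing.Theory Num.Theory.
Local Open Scope ring_scope.
Local Open Scope sesquilinear_scope.
Local Open Scope complex_scope.

(* The graph that carries the qubits.  It may be infinite and may have
   unoccupied sites, where qubits can be added later. *)
Record lattice := Lattice {
  site :> eqType;
  adj : rel site;
  adj_sym : symmetric adj;
  adj_irr : irreflexive adj
}.

(* The graph distance from x to y is smaller than r. *)
Definition dist_lt (G : lattice) (r : nat) (x y : G) : Prop :=
  exists p : seq G, [/\ path (@adj G) x p, last x p = y & (size p < r)%N].

(* A sequence of graphs of spatial dimension (at most) d: balls have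
   polynomial growth of degree d, with a constant common to all the graphs. *)
Definition spatial_dim (G : nat -> lattice) (d : nat) : Prop :=
  exists c : nat, forall (k : nat) (x : G k) (r : nat) (s : seq (G k)),
    uniq s -> {in s, forall y, dist_lt r x y} -> (size s <= c * r ^ d)%N.

(* A finite set of qubits placed on distinct sites. *)
Record qubits (G : lattice) := Qubits {
  qubit :> finType;
  pos : qubit -> G;
  pos_inj : injective pos
}.

(* Labels of the standard basis of the tensor product of the C^2's. *)
Definition cfg (Q : finType) : finType := {ffun Q -> 'I_2}.

Section Qubits.
Variable R : realType.
Local Notation C := R[i].

(* The Hilbert space (C^2)^{\otimes Q}, and the operators from
   (C^2)^{\otimes Q} to (C^2)^{\otimes Q'}; the basis label s : cfg Q is row
   (or column) number enum_rank s. *)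
Definition state (Q : finType) := 'cV[C]_#|cfg Q|.
Definition oper (Q Q' : finType) := 'M[C]_(#|cfg Q'|, #|cfg Q|).

Definition prod_state (Q : finType) (psi : Q -> 'cV[C]_2) : state Q :=
  \col_i \prod_(q : Q) psi q ((enum_val i : cfg Q) q) 0.

Definition ket0 : 'cV[C]_2 := delta_mx 0 0.
Definition ket1 : 'cV[C]_2 := delta_mx 1 0.

Definition all0 (Q : finType) : state Q := prod_state (fun _ : Q => ket0).
Definition all1 (Q : finType) : state Q := prod_state (fun _ : Q => ket1).

Definition GHZ_plus (Q : finType) (a b : C) : state Q :=
  a *: all0 Q + b *: all1 Q.

Definition region (Q : finType) (X : {set Q}) : finType := {q : Q | q \in X}.

Definition cfg_restr (Q : finType) (X : {set Q}) (s : cfg Q) : cfg (region X) :=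
  [ffun u : region X => s (val u)].

(* A \otimes I, with A acting on the qubits of X and I on the others. *)
Definition local_op (Q : finType) (X : {set Q})
    (A : oper (region X) (region X)) : oper Q Q :=
  \matrix_(i, j)
    (let s : cfg Q := enum_val i in
     let t : cfg Q := enum_val j in
     if [forall q, (q \notin X) ==> (s q == t q)]
     then A (enum_rank (cfg_restr X s)) (enum_rank (cfg_restr X t))
     else 0).

(* |Psi> |-> (\otimes_q |psi_q>) \otimes |Psi>, where f identifies the old
   qubits among those of Q' and q ranges over the new ones. *)
Definition tensor_op (Q Q' : finType) (f : Q -> Q') (psi : Q' -> 'cV[C]_2) :
    oper Q Q' :=
  \matrix_(i, j)
    (let s : cfg Q' := enum_val i in
     let t : cfg Q := enum_val j in
     if [forall q, t q == s (f q)]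
     then \prod_(q | q \notin codom f) psi q (s q) 0
     else 0).

(* The order of Hermitian operators: B - A is positive semidefinite. *)
Definition loewner_le (n : nat) (A B : 'M[C]_n) : Prop :=
  forall v : 'cV[C]_n, 0 <= (v^t* *m (B - A) *m v) 0 0.

(* The size of a region is smaller than l, both as a number of qubits and as
   a diameter in the graph; in bounded dimension the second bound gives the
   first one up to a change of l. *)
Definition size_lt (G : lattice) (Q : qubits G) (l : nat) (X : {set Q}) : Prop :=
  (#|X| < l)%N /\ {in X &, forall q q', dist_lt l (pos q) (pos q')}.

Definition SL_layer (G : lattice) (Q : qubits G) (l : nat) (W : oper Q Q) : Prop :=
  exists (n : nat) (X : 'I_n -> {set Q})
         (A : forall i, oper (region (X i)) (region (X i))),
    [/\ forall i j, i != j -> [disjoint X i & X j],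
        forall i, size_lt l (X i),
        forall i, A i \in unitmx /\ loewner_le ((A i)^t* *m A i) 1%:M
      & W = \big[mulmx/1%:M]_(i < n) local_op (A i)].

(* M layers of range l. *)
Definition SL (G : lattice) (Q : qubits G) (l M : nat) (W : oper Q Q) : Prop :=
  exists U : 'I_M -> oper Q Q,
    (forall i, SL_layer l (U i)) /\ W = \big[mulmx/1%:M]_(i < M) U i.

(* Composition of m steps, each one an SL transformation (M layers of range l)
   or the addition of qubits in a product state.  The old qubits stay at their
   sites, and the states of the added qubits have norm 1: otherwise rescaling
   them would make the success probability in convertible arbitrary. *)
Inductive gSL (G : lattice) (l M : nat) (Q : qubits G) :
    nat -> forall Q' : qubits G, oper Q Q' -> Prop :=
| gSL_id : gSL l M 0 (1%:M : oper Q Q)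
| gSL_SL (m : nat) (Q1 : qubits G) (W : oper Q Q1) (U : oper Q1 Q1) :
    gSL l M m W -> SL l M U -> gSL l M m.+1 (U *m W : oper Q Q1)
| gSL_tensor (m : nat) (Q1 Q2 : qubits G) (W : oper Q Q1)
      (f : Q1 -> Q2) (psi : Q2 -> 'cV[C]_2) :
    gSL l M m W ->
    (forall q, pos (f q) = pos q) ->
    (forall q, q \notin codom f -> (psi q)^t* *m psi q = 1%:M) ->
    gSL l M m.+1 (tensor_op f psi *m W : oper Q Q2).

(* The square root of a positive semidefinite matrix, from its spectral
   decomposition. *)
Definition psd_sqrt (n : nat) (B : 'M[C]_n) : 'M[C]_n :=
  invmx (spectralmx B) *m diag_mx (map_mx sqrtC (spectral_diag B))
    *m spectralmx B.

Definition trnorm (n : nat) (A : 'M[C]_n) : C := \tr (psd_sqrt (A^t* *m A)).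

Definition proj (n : nat) (v : 'cV[C]_n) : 'M[C]_n := v *m v^t*.

Definition normalize (n : nat) (rho : 'M[C]_n) : 'M[C]_n := (\tr rho)^-1 *: rho.

(* The bounds l, M, m on the transformations may depend on eps, but not on the
   size. *)
Definition gSL_convertible (G : nat -> lattice) (Q Q' : forall k, qubits (G k))
    (Psi : forall k, state (Q k)) (Phi : forall k, state (Q' k)) : Prop :=
  forall eps : R, 0 < eps ->
  exists (N0 : nat) (p : R) (l M m : nat) (W : forall k, oper (Q k) (Q' k)),
    [/\ 0 < p < 1,
        forall k, gSL l M m (W k)
      & forall k, (N0 < #|Q k|)%N ->
          trnorm (normalize (W k *m proj (Psi k) *m (W k)^t*)
                  - normalize (proj (Phi k))) < eps%:C
          /\ p%:C < \tr (W k *m proj (Psi k) *m (W k)^t*) / \tr (proj (Psi k))].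

End Qubits.

(* Main.v *)
Require Import Defs.
From mathcomp Require Import all_boot all_order all_algebra.
From mathcomp Require Import perm complex.
From mathcomp Require Import boolp classical_sets reals topology.

(** If a <> 0, apply diag(1, g) to every qubit, with 0 < g <= 1: this fixes
    |0...0> and multiplies |1...1> by g^N, so that the normalized result is at
    trace-norm distance at most 2 g / |a| from |0...0>, and the success
    probability is at least |a|^2.  If a = 0, flip every qubit.  Both
    transformations are single layers of one-qubit operators.

    For unit vectors u and v, A = uu* - vv* satisfies A^3 = (1 - |<u,v>|^2) A;
    the eigenvalues of A*A are thus 0 and 1 - |<u,v>|^2, which gives the trace
    norm of A without diagonalizing it. *)

Set Implicit Arguments.
Unset Strict Implicit.
Unset Printing Implicit Defensive.

Import Order.TTheory GRing.Theory Num.Theory.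
Local Open Scope ring_scope.
Local Open Scope complex_scope.
Local Open Scope sesquilinear_scope.

(** * Square roots of matrices with one nonzero eigenvalue *)

Section SpectralSqrt.
Variable C : numClosedFieldType.

(* For c = 0 both sides are 0, since 1 / 0 = 0. *)
Lemma mxtrace_spectral_sqrt n (B : 'M[C]_n) (c : C) :
  B \is normalmx -> B *m B = c *: B ->
  \tr (invmx (spectralmx B) *m diag_mx (map_mx sqrtC (spectral_diag B))
         *m spectralmx B) = \tr B / sqrtC c.
Proof.
move=> /orthomx_spectralP; set P := spectralmx B; set D := spectral_diag B.
have Pu : P \in unitmx by apply: spectral_unit.
have trP M : \tr (invmx P *m M *m P) = \tr M.
  by rewrite mxtrace_mulC mulmxA mulmxV // mul1mx.
rewrite trP mxtrace_diag => eB B2; rewrite [in RHS]eB trP mxtrace_diag.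
rewrite mulr_suml; apply: eq_bigr => i _; rewrite mxE.
have D2 : diag_mx D *m diag_mx D = c *: diag_mx D.
  move: B2; rewrite eB => /(congr1 (fun X => P *m X *m invmx P)).
  by rewrite -scalemxAr -scalemxAl !mulmxA mulmxV // mul1mx !mulmxK.
(* Each eigenvalue [d] satisfies [d * d = c * d], so it is 0 or [c]; in both cases its square root
   is [d / sqrtC c]. *)
have /matrixP/(_ i i) := D2.
rewrite mulmx_diag !mxE eqxx !mulr1n => /eqP.
rewrite -subr_eq0 -mulrBl mulf_eq0 subr_eq0 => /orP[]/eqP->.
  have [->|c0] := eqVneq c 0; first by rewrite sqrtC0 mul0r.
  by apply: (canRL (mulfK _)); rewrite ?sqrtC_eq0 // -expr2 sqrtCK.
by rewrite sqrtC0 mul0r.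
Qed.

(** [A] preserves the span of [u] and [v], and [A *m A] multiplies both vectors by [c]. The columns
    of [A] lie in that span, whence the cubic identity. *)
Lemma ket_bra_sub_sqr n (u v : 'cV[C]_n) (A := u *m u^t* - v *m v^t*)
    (c := 1 - `|(u^t* *m v) 0 0| ^+ 2) :
  u^t* *m u = 1%:M -> v^t* *m v = 1%:M ->
  [/\ A^t* = A, A *m A *m A = c *: A & \tr (A *m A) = c *+ 2].
Proof.
move=> uu vv; pose z := (u^t* *m v) 0 0.
have uv : u^t* *m v = z%:M by rewrite -mx11_scalar.
have vu : v^t* *m u = (Num.conj z)%:M.
  by rewrite -[LHS]trmxCK trmx_mul map_mxM trmxCK uv tr_scalar_mx map_scalar_mx.
have Au : A *m u = u - Num.conj z *: v.
  by rewrite mulmxBl -!mulmxA uu vu mulmx1 mul_mx_scalar.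
have Av : A *m v = z *: u - v.
  by rewrite mulmxBl -!mulmxA vv uv mulmx1 mul_mx_scalar.
have AAu : A *m A *m u = c *: u.
  rewrite -mulmxA Au mulmxBr -scalemxAr Au Av scalerBr scalerA opprB addrA.
  by rewrite subrK scalerBl scale1r /c normCK mulrC.
have AAv : A *m A *m v = c *: v.
  rewrite -mulmxA Av mulmxBr -scalemxAr Au Av scalerBr scalerA opprB.
  by rewrite addrC addrA subrK scalerBl scale1r /c normCK.
split.
- by rewrite /A linearB /= map_mxB !trmx_mul !map_mxM !trmxCK.
- by rewrite {3}/A mulmxBr !(mulmxA (A *m A)) AAu AAv -!scalemxAl -scalerBr.
rewrite {2}/A mulmxBr !mulmxA Au Av linearB /= !mulmxBl -!scalemxAl !linearB.
rewrite /= !mxtraceZ ![\tr (_ *m _^t*)]mxtrace_mulC uu vv uv vu.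
rewrite !mxtrace_scalar !mulr1n opprB (mulrC (Num.conj z)).
by rewrite -normCK.
Qed.

End SpectralSqrt.

(** * Trace distance between two pure states *)

Section TraceNorm.
Variable R : realType.
Local Notation C := R[i].

(** With [A] Hermitian, [B = A *m A] satisfies [B *m B = c *: B] and has trace [2c], so its square
    root has trace [2c / sqrtC c]. When [c = 0] both sides vanish by the convention on division. *)
Lemma trnorm_proj_sub n (u v : 'cV[C]_n) :
  u^t* *m u = 1%:M -> v^t* *m v = 1%:M ->
  trnorm (proj u - proj v) = sqrtC (1 - `|(u^t* *m v) 0 0| ^+ 2) *+ 2.
Proof.
move=> uu vv; have [Ah A3 trA] := ket_bra_sub_sqr uu vv.
set c := 1 - _ in A3 trA *; set A := proj u - proj v.
rewrite /trnorm (_ : A^t* *m A = A *m A); last by rewrite Ah.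
rewrite /psd_sqrt (mxtrace_spectral_sqrt (c := c)); first last.
- by rewrite mulmxA A3 scalemxAl.
- by apply/normalmxP; rewrite trmx_mul map_mxM Ah.
rewrite trA; have [->|c0] := eqVneq c 0; first by rewrite sqrtC0 mul0rn mul0r.
by apply: (canLR (mulfK _)); rewrite ?sqrtC_eq0 // mulrnAl -expr2 sqrtCK.
Qed.
End TraceNorm.

(** * Tensor products of one-qubit operators *)

Section TensorOperators.
Variable R : realType.
Local Notation C := R[i].

Lemma sum_cfg (Q : finType) (F : cfg Q -> C) :
  \sum_(i < #|cfg Q|) F (enum_val i) = \sum_(s : cfg Q) F s.
Proof. by rewrite -(big_enum_val F). Qed.

(** The tensor product of the operators [w q], written in the basis labelled by configurations. *)
Definition tens (Q : finType) (w : Q -> 'M[C]_2) : oper R Q Q :=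
  \matrix_(i, j) \prod_q w q ((enum_val i : cfg Q) q) ((enum_val j : cfg Q) q).

Lemma eq_tens (Q : finType) (w w' : Q -> 'M[C]_2) :
  w =1 w' -> tens w = tens w'.
Proof. by move=> /funext->. Qed.

(** A sum over configurations of a product over qubits is the product over qubits of sums over the
    two basis labels. [tensM] and [dot_prod_state] rest on the same exchange. *)
Lemma tens_prod_state (Q : finType) (w : Q -> 'M[C]_2) psi :
  tens w *m prod_state psi = prod_state (fun q => w q *m psi q).
Proof.
apply/matrixP => i j; rewrite mxE [RHS]mxE.
under [LHS]eq_bigr do rewrite !mxE -big_split /=.
set s := (enum_val i : cfg Q).
rewrite (sum_cfg (fun t => \prod_q (w q (s q) (t q) * psi q (t q) 0))).
rewrite -(bigA_distr_bigA (fun q c => w q (s q) c * psi q c 0)).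
by apply: eq_bigr => q _; rewrite mxE.
Qed.

Lemma tensM (Q : finType) (w w' : Q -> 'M[C]_2) :
  tens w *m tens w' = tens (fun q => w q *m w' q).
Proof.
apply/matrixP => i j; rewrite mxE [RHS]mxE.
under [LHS]eq_bigr do rewrite !mxE -big_split /=.
set s := (enum_val i : cfg Q); set s' := (enum_val j : cfg Q).
rewrite (sum_cfg (fun t => \prod_q (w q (s q) (t q) * w' q (t q) (s' q)))).
rewrite -(bigA_distr_bigA (fun q c => w q (s q) c * w' q c (s' q))).
by apply: eq_bigr => q _; rewrite mxE.
Qed.

Lemma tens_diag (Q : finType) (D : Q -> 'rV[C]_2) :
  tens (fun q => diag_mx (D q)) =
  diag_mx (\row_i \prod_q D q 0 ((enum_val i : cfg Q) q)).
Proof.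
apply/matrixP => i j; rewrite !mxE; have [->|ij] := eqVneq i j.
  by rewrite mulr1n; apply: eq_bigr => q _; rewrite mxE eqxx.
rewrite mulr0n.
(* Off the diagonal, the two configurations differ at some qubit, whose factor vanishes. *)
have [q qij] : exists q, (enum_val i : cfg Q) q != (enum_val j : cfg Q) q.
  apply/existsP; rewrite -negb_forall; apply: contra ij => /forallP e.
  by apply/eqP/enum_val_inj/ffunP => q; apply/eqP.
by rewrite (bigD1 q) //= mxE (negPf qij) mulr0n mul0r.
Qed.

Lemma tens1 (Q : finType) : tens (fun _ : Q => 1%:M) = 1%:M.
Proof.
rewrite -diag_const_mx tens_diag -[RHS]diag_const_mx; congr diag_mx.
by apply/rowP => i; rewrite !mxE big1 // => q _; rewrite mxE.
Qed.

Lemma tens_adj (Q : finType) (w : Q -> 'M[C]_2) :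
  (tens w)^t* = tens (fun q => (w q)^t*).
Proof.
apply/matrixP => i j; rewrite !mxE rmorph_prod.
by apply: eq_bigr => q _; rewrite !mxE.
Qed.

Lemma tens_unitmx (Q : finType) (w : Q -> 'M[C]_2) :
  (forall q, w q \in unitmx) -> tens w \in unitmx.
Proof.
move=> wu.
suff /mulmx1_unit[] : tens w *m tens (fun q => invmx (w q)) = 1%:M by [].
by rewrite tensM -tens1; apply: eq_tens => q; rewrite mulmxV.
Qed.

(** The identity factors outside [X] contribute exactly the test, made in [local_op], that the two
    configurations agree there. *)
Lemma local_op_tens (Q : finType) (X : {set Q}) (w : Q -> 'M[C]_2) :
  local_op (tens (fun u : region X => w (val u))) =
  tens (fun q => if q \in X then w q else 1%:M).
Proof.
apply/matrixP => i j; rewrite mxE [RHS]mxE /=.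
set s := (enum_val i : cfg Q); set t := (enum_val j : cfg Q).
rewrite (bigID (mem X)) /= mulrC.
case: ifPn => [/forallP st|].
  rewrite mxE !enum_rankK [X in _ = X * _]big1 ?mul1r => [|q qX]; last first.
    by rewrite (negPf qX) mxE (implyP (st q) qX).
  rewrite (big_sub (mem X)) /=; apply: eq_bigr => u _.
  by rewrite !ffunE (valP u).
rewrite negb_forall => /existsP[q]; rewrite negb_imply => /andP[qX stq].
by rewrite (bigD1 q) //= (negPf qX) mxE (negPf stq) !mul0r.
Qed.

Lemma prod_tens (Q : finType) n (w : 'I_n -> Q -> 'M[C]_2) :
  \big[mulmx/1%:M]_(i < n) tens (w i) =
  tens (fun q => \big[mulmx/1%:M]_(i < n) w i q).
Proof.
elim: n w => [|n IH] w.
  by rewrite big_ord0 -tens1; apply: eq_tens => q; rewrite big_ord0.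
rewrite big_ord_recl IH tensM; apply: eq_tens => q.
by rewrite big_ord_recl.
Qed.

(** The quadratic form of [1%:M - diag_mx D] is the sum of the [(1 - D 0 i) * |v i|^2]. *)
Lemma loewner_le_diag n (D : 'rV[C]_n) :
  (forall i, D 0 i <= 1) -> loewner_le (diag_mx D) 1%:M.
Proof.
move=> D1 v; rewrite -diag_const_mx -linearB /= -mulmxA mul_diag_mx mxE.
apply: sumr_ge0 => i _; rewrite !mxE.
by rewrite mulrCA -normCKC mulr_ge0 ?subr_ge0 ?exprn_ge0.
Qed.

(** Each region is a single qubit, of cardinal 1 and diameter 0, hence the range 2. The flip and the
    damping both have a diagonal [w^t* *m w], which reduces contractivity to a bound on its
    entries. *)
Lemma SL_layer_tens (G : lattice) (Q : qubits G) (w : 'M[C]_2) (D : 'rV[C]_2) :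
  w \in unitmx -> w^t* *m w = diag_mx D -> (forall i, 0 <= D 0 i <= 1) ->
  SL_layer 2 (tens (fun _ : Q => w)).
Proof.
move=> wu wD D01; exists #|Q|, (fun i => [set enum_val i]).
exists (fun i => tens (fun _ => w)); split.
- by move=> i j ij; rewrite disjoints1 finset.in_set1 (inj_eq enum_val_inj).
- move=> i; split; first by rewrite cards1.
  by move=> q q' /finset.set1P-> /finset.set1P->; exists [::].
- move=> i; split; first exact: tens_unitmx.
  rewrite tens_adj tensM wD tens_diag; apply: loewner_le_diag => k.
  rewrite mxE; by apply: prodr_ile1 => q _; exact: D01.
under [RHS]eq_bigr do rewrite (local_op_tens _ (fun=> w)).
rewrite prod_tens; apply: eq_tens => q; apply/esym.
(* At qubit [q], only the layer factor of its own singleton differs from the identity. *)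
rewrite (big_only1 (op := *%R) (enum_rank q)) ?enum_rankK ?set11 // => j jq _.
by rewrite finset.in_set1 -(inj_eq enum_rank_inj) enum_valK eq_sym (negPf jq).
Qed.

End TensorOperators.

(** * Inner products and the distance from a GHZ state to the product state *)

Section ProductStates.
Variable R : realType.
Local Notation C := R[i].

Lemma adjD m n (A B : 'M[C]_(m, n)) : (A + B)^t* = A^t* + B^t*.
Proof. by rewrite linearD map_mxD. Qed.

Lemma adjZ m n (c : C) (A : 'M[C]_(m, n)) : (c *: A)^t* = Num.conj c *: A^t*.
Proof. by rewrite linearZ map_mxZ. Qed.

Lemma dot_prod_state (Q : finType) (psi phi : Q -> 'cV[C]_2) :
  (prod_state psi)^t* *m prod_state phi =
  (\prod_q ((psi q)^t* *m phi q) 0 0)%:M.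
Proof.
rewrite [LHS]mx11_scalar mxE; congr _%:M.
under [LHS]eq_bigr do rewrite !mxE rmorph_prod -big_split /=.
rewrite (sum_cfg (fun s => \prod_q (Num.conj (psi q (s q) 0) * phi q (s q) 0))).
rewrite -(bigA_distr_bigA (fun q c => Num.conj (psi q c 0) * phi q c 0)).
by apply: eq_bigr => q _; rewrite mxE; apply: eq_bigr => c _; rewrite !mxE.
Qed.

Lemma prod_stateZ (Q : finType) (c : Q -> C) (psi : Q -> 'cV[C]_2) :
  prod_state (fun q => c q *: psi q) = (\prod_q c q) *: prod_state psi.
Proof.
apply/colP => i; rewrite !mxE -big_split.
by apply: eq_bigr => q _; rewrite mxE.
Qed.

Lemma eq_prod_state (Q : finType) (psi phi : Q -> 'cV[C]_2) :
  psi =1 phi -> prod_state psi = prod_state phi.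
Proof. by move=> /funext->. Qed.

Lemma dot_ket i j :
  (delta_mx i 0 : 'cV[C]_2)^t* *m (delta_mx j 0 : 'cV[C]_2) = (i == j)%:R%:M.
Proof.
rewrite trmx_delta map_delta_mx mul_delta_mx_cond [LHS]mx11_scalar.
by rewrite mulmxnE mxE !eqxx -mulr_natl mulr1.
Qed.

Lemma dot_all0 (Q : finType) : (all0 R Q)^t* *m all0 R Q = 1%:M.
Proof. by rewrite dot_prod_state big1 // => q _; rewrite dot_ket mxE. Qed.

Lemma dot_all1 (Q : finType) : (all1 R Q)^t* *m all1 R Q = 1%:M.
Proof. by rewrite dot_prod_state big1 // => q _; rewrite dot_ket mxE. Qed.

(** One qubit is enough to make the product of overlaps zero; on the empty set of qubits the two
    states coincide. *)
Lemma dot_all0_all1 (Q : finType) :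
  (0 < #|Q|)%N -> (all0 R Q)^t* *m all1 R Q = 0.
Proof.
case/card_gt0P => q _.
by rewrite dot_prod_state (bigD1 q) //= dot_ket mxE mul0rn mul0r raddf0.
Qed.

Lemma dot_all1_all0 (Q : finType) :
  (0 < #|Q|)%N -> (all1 R Q)^t* *m all0 R Q = 0.
Proof.
move=> Q0; rewrite -[LHS]trmxCK trmx_mul map_mxM trmxCK.
by rewrite dot_all0_all1 // trmx0 map_mx0.
Qed.

Lemma dot_GHZ (Q : finType) (x y : C) : (0 < #|Q|)%N ->
  (GHZ_plus Q x y)^t* *m GHZ_plus Q x y = (`|x| ^+ 2 + `|y| ^+ 2)%:M.
Proof.
move=> Q0; rewrite /GHZ_plus adjD !adjZ.
rewrite mulmxDl !mulmxDr -!scalemxAl -!scalemxAr dot_all0 dot_all1.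
rewrite dot_all0_all1 // dot_all1_all0 // !scaler0 addr0 add0r !scale_scalar_mx.
by rewrite !mulr1 -!normCKC -raddfD.
Qed.

Lemma dot_GHZ_all0 (Q : finType) (x y : C) : (0 < #|Q|)%N ->
  (all0 R Q)^t* *m GHZ_plus Q x y = x%:M.
Proof.
move=> Q0; rewrite mulmxDr -!scalemxAr dot_all0 dot_all0_all1 //.
by rewrite scaler0 addr0 scale_scalar_mx mulr1.
Qed.

Lemma mxtrace_proj n (v : 'cV[C]_n) : \tr (proj v) = (v^t* *m v) 0 0.
Proof. by rewrite mxtrace_mulC [X in \tr X]mx11_scalar mxtrace_scalar. Qed.

Lemma mul_proj n m (W : 'M[C]_(m, n)) (v : 'cV[C]_n) :
  W *m proj v *m W^t* = proj (W *m v).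
Proof. by rewrite /proj trmx_mul map_mxM !mulmxA. Qed.

(** The normalized vector has squared overlap [|x|^2 / n] with [all0], and
    [1 - |x|^2 / n = |y|^2 / n]. *)
Lemma trnorm_normalize_GHZ (Q : finType) (x y : C)
    (n := `|x| ^+ 2 + `|y| ^+ 2) :
  (0 < #|Q|)%N -> n != 0 ->
  trnorm (normalize (proj (GHZ_plus Q x y)) - normalize (proj (all0 R Q)))
  = sqrtC (`|y| ^+ 2 / n) *+ 2.
Proof.
move=> Q0 n0; have n_ge0 : 0 <= n by rewrite addr_ge0 ?exprn_ge0.
(* Scaling the vector by [r] scales its projection by [n^-1], which gives the projection on a unit
   vector. *)
pose r := sqrtC n^-1; have r_ge0 : 0 <= r by rewrite sqrtC_ge0 invr_ge0.
have r2 : r * r = n^-1 by rewrite -expr2 sqrtCK.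
have rc : Num.conj r = r by rewrite geC0_conj.
rewrite /normalize !mxtrace_proj dot_all0 dot_GHZ // !mxE eqxx !mulr1n.
rewrite invr1 scale1r.
have -> : n^-1 *: proj (GHZ_plus Q x y) = proj (r *: GHZ_plus Q x y).
  by rewrite /proj adjZ -scalemxAl -scalemxAr scalerA rc r2.
rewrite trnorm_proj_sub ?dot_all0 //; last first.
  rewrite adjZ -scalemxAl -scalemxAr scalerA rc r2 dot_GHZ //.
  by rewrite scale_scalar_mx mulVf.
rewrite -[(_ *: _)^t* *m _]trmxCK trmx_mul map_mxM trmxCK -scalemxAr.
rewrite dot_GHZ_all0 //.
rewrite !mxE eqxx mulr1n norm_conjC normrM exprMn (ger0_norm r_ge0) sqrtCK.
congr (sqrtC _ *+ 2).
apply: (canRL (mulfK n0)).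
by rewrite mulrBl mul1r mulrAC mulVf // mul1r /n addrC addKr.
Qed.

(** Both bounds come from [|x|^2 <= n]: the distance is at most [2 |y| / |x|], and the trace is
    [n]. *)
Lemma trnorm_normalize_GHZ_lt (Q : finType) (x y : C) (eps p : R) :
  (0 < #|Q|)%N -> x != 0 -> `|y| *+ 2 < eps%:C * `|x| -> p%:C < `|x| ^+ 2 ->
  trnorm (normalize (proj (GHZ_plus Q x y)) - normalize (proj (all0 R Q)))
    < eps%:C /\ p%:C < \tr (proj (GHZ_plus Q x y)).
Proof.
move=> Q0 x0 xy px; set n := `|x| ^+ 2 + `|y| ^+ 2.
have xn : `|x| ^+ 2 <= n by rewrite lerDl exprn_ge0.
have x2 : 0 < `|x| ^+ 2 by rewrite exprn_gt0 ?normr_gt0.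
have n_gt0 : 0 < n by apply: lt_le_trans xn.
split; last by rewrite mxtrace_proj dot_GHZ // mxE eqxx mulr1n (lt_le_trans px).
rewrite trnorm_normalize_GHZ ?gt_eqF //.
have : sqrtC (`|y| ^+ 2 / n) <= `|y| / `|x|.
  have yx0 : 0 <= `|y| / `|x| by rewrite divr_ge0.
  have yn0 : 0 <= `|y| ^+ 2 / n by rewrite divr_ge0 ?exprn_ge0 // ltW.
  rewrite -[leRHS](sqrCK yx0) ler_sqrtC ?nnegrE ?exprn_ge0 // expr_div_n.
  by rewrite ler_wpM2l ?exprn_ge0 // lef_pV2 ?posrE.
rewrite -(ler_pMn2r (isT : (0 < 2)%N)) => /le_lt_trans; apply.
by rewrite -mulrnAl ltr_pdivrMr ?normr_gt0.
Qed.

End ProductStates.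

(** * Conversion by one layer of identical one-qubit operators *)

Section Conversion.
Variable R : realType.
Local Notation C := R[i].

Lemma gSL_tens (G : lattice) (Q : qubits G) (w : 'M[C]_2) (D : 'rV[C]_2) :
  w \in unitmx -> w^t* *m w = diag_mx D -> (forall i, 0 <= D 0 i <= 1) ->
  gSL 2 1 1 (tens (fun _ : Q => w)).
Proof.
move=> wu wD D01; rewrite -[tens _]mulmx1.
apply: gSL_SL; first exact: gSL_id.
exists (fun=> tens (fun _ : Q => w)).
split; last by rewrite big_ord_recl big_ord0 mulmx1.
by move=> _; apply: SL_layer_tens wD D01.
Qed.

(** [w] and [p] are chosen before the set [T] of qubits, so they depend on [eps] alone. The source
    has norm 1, so the success probability is the trace of the unnormalized image. *)
Lemma gSL_convertible_tens (G : nat -> lattice) (Q : forall k, qubits (G k))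
    (a b : C) :
  (forall k, (0 < #|Q k|)%N) -> `|a| ^+ 2 + `|b| ^+ 2 = 1 ->
  (forall eps : R, 0 < eps -> exists (w : 'M[C]_2) (D : 'rV[C]_2) (p : R),
    [/\ w \in unitmx, w^t* *m w = diag_mx D, forall i, 0 <= D 0 i <= 1,
        0 < p < 1 &
        forall T : finType, (0 < #|T|)%N -> exists x y : C,
        [/\ tens (fun _ : T => w) *m GHZ_plus T a b = GHZ_plus T x y,
            x != 0, `|y| *+ 2 < eps%:C * `|x| & p%:C < `|x| ^+ 2]]) ->
  gSL_convertible (fun k => GHZ_plus (Q k) a b) (fun k => all0 R (Q k)).
Proof.
move=> Q0 ab H eps /H[w [D [p [wu wD D01 p01 wGHZ]]]].
exists 0%N, p, 2, 1, 1, (fun k => tens (fun _ : Q k => w)); split=> //.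
  by move=> k; apply: gSL_tens wD D01.
move=> k _; have [x [y [e x0 xy px]]] := wGHZ _ (Q0 k).
rewrite mul_proj e [X in _ / X]mxtrace_proj dot_GHZ // ab !mxE eqxx mulr1n.
rewrite divr1; exact: trnorm_normalize_GHZ_lt.
Qed.

Lemma tens_all0 (Q : finType) (w : 'M[C]_2) :
  tens (fun _ : Q => w) *m all0 R Q = prod_state (fun=> col 0 w).
Proof. by rewrite tens_prod_state; apply: eq_prod_state => q; rewrite colE. Qed.

Lemma tens_all1 (Q : finType) (w : 'M[C]_2) :
  tens (fun _ : Q => w) *m all1 R Q = prod_state (fun=> col 1 w).
Proof. by rewrite tens_prod_state; apply: eq_prod_state => q; rewrite colE. Qed.

Lemma tens_tperm_GHZ (Q : finType) (a b : C) :
  tens (fun _ : Q => tperm_mx 0 1) *m GHZ_plus Q a b = GHZ_plus Q b a.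
Proof.
rewrite mulmxDr -!scalemxAr tens_all0 tens_all1 addrC.
congr (_ *: _ + _ *: _); apply: eq_prod_state => q; apply/colP => i;
  rewrite !mxE eqxx andbT (canF_eq (permK _)) tpermV.
  by rewrite tpermR.
by rewrite tpermL.
Qed.

(** A row vector, so that [damp g] gives the operator and [damp (g ^+ 2)] the diagonal of its
    adjoint times itself. *)
Definition damp (g : C) : 'rV[C]_2 := \row_j (if j == 0 then 1 else g).

Lemma tens_damp_GHZ (Q : finType) (g a b : C) :
  tens (fun _ : Q => diag_mx (damp g)) *m GHZ_plus Q a b =
  GHZ_plus Q a (g ^+ #|Q| * b).
Proof.
rewrite mulmxDr -!scalemxAr tens_all0 tens_all1; congr (_ *: _ + _).
  apply: eq_prod_state => q; apply/colP => i; rewrite !mxE eqxx andbT.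
  by case: eqP.
rewrite (eq_prod_state (phi := fun=> g *: ket1 R)); last first.
  by move=> q; apply/colP => i; rewrite !mxE; case: i => -[|[|//]] i /=;
     rewrite ?mulr0 ?mulr1.
by rewrite (prod_stateZ (fun=> g)) prodr_const scalerA mulrC.
Qed.

End Conversion.

(** * Choice of the one-qubit operator *)

Local Open Scope classical_set_scope.

Theorem mainTheorem1 (R : realType) (N : nat -> nat) (a b : R[i])
    (G : nat -> lattice) (d : nat) (Q : forall k, qubits (G k)) :
  (forall k, (0 < N k)%N) ->
  N k @[k --> \oo] --> \oo ->
  spatial_dim G d ->
  (forall k, #|Q k| = N k) ->
  `|a| ^+ 2 + `|b| ^+ 2 = 1 ->
  gSL_convertible (fun k => GHZ_plus (Q k) a b) (fun k => all0 R (Q k)).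
Proof.
move=> N0 _ _ QN ab.
apply: gSL_convertible_tens => [k||eps eps0] //; first by rewrite QN.
have eps0C : 0 < eps%:C by rewrite -[0]/(0%:C) ltcR.
have [a0|a0] := eqVneq a 0.
  (* The flip is unitary, hence the constant diagonal 1. It exchanges the coefficients, and
     [|b|^2 = 1] exceeds the threshold 1/2. *)
  exists (tperm_mx 0 1), (const_mx 1), 2^-1; split.
  - exact: unitmx_perm.
  - by rewrite tr_tperm_mx map_tperm_mx -perm_mxM tperm2 perm_mx1 diag_const_mx.
  - by move=> i; rewrite mxE ler01 lexx.
  - by rewrite invr_gt0 ltr0n invf_lt1 ?ltr0n // ltr1n.
  move=> T _; exists b, a; rewrite tens_tperm_GHZ a0.
  move: ab; rewrite a0 normr0 expr0n add0r => b1.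
  have b0 : b != 0.
    by apply: contra_eq_neq b1 => ->; rewrite normr0 expr0n eq_sym oner_neq0.
  split => //; first by rewrite mul0rn mulr_gt0 ?normr_gt0.
  have : (2^-1 : R) < 1 by rewrite invf_lt1 ?ltr0n // ltr1n.
  by rewrite b1 -ltcR.
have na : 0 < `|a| by rewrite normr_gt0.
have sq_le1 x y : 0 <= x -> 0 <= y -> x ^+ 2 + y ^+ 2 = 1 -> x <= 1 :> R[i].
  by move=> x0 y0 e; rewrite -(@expr_le1 _ 2) // -e lerDl exprn_ge0.
have a1 : `|a| <= 1 by apply: sq_le1 ab.
have b1 : `|b| <= 1 by apply: (sq_le1 _ `|a|) => //; rewrite addrC.
(* The fraction is less than both 1 and [eps / 2], so that [g <= 1] and [2g < eps |a|]. *)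
pose g := `|a| * (eps%:C / (4 + eps%:C)).
have e4 : 0 < 4 + eps%:C by rewrite addr_gt0 ?ltr0n.
have g0 : 0 < g by rewrite mulr_gt0 ?divr_gt0.
have g1 : g <= 1.
  rewrite mulr_ile1 ?divr_ge0 // ?ltW // ltr_pdivrMr //.
  by rewrite mul1r ltrDr ltr0n.
have g2 : g *+ 2 < eps%:C * `|a|.
  rewrite /g -mulrnAr mulrC ltr_pM2r // -mulrnAl ltr_pdivrMr //.
  by rewrite -mulr_natr ltr_pM2l // (lt_trans (y := 4)) ?ltr_nat // ltrDl.
(* The probability bound must lie in [R], whereas [|a|^2] has type [R[i]]. *)
pose r := complex.Re (`|a| ^+ 2).
have rE : r%:C = `|a| ^+ 2 by rewrite RRe_real // realE exprn_ge0.
have r0 : 0 < r by rewrite -ltcR rE; exact: exprn_gt0.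
have r1 : r <= 1 by rewrite -lecR rE; apply: exprn_ile1.
(* Halving [r] makes the bound strictly less than both [|a|^2] and 1, even when [|a| = 1]. *)
exists (diag_mx (damp g)), (damp (g ^+ 2)), (r / 2); split.
- rewrite unitmxE det_diag !big_ord_recl big_ord0 !mxE /=.
  by rewrite mul1r mulr1 unitfE gt_eqF.
- rewrite tr_diag_mx map_diag_mx mulmx_diag; congr diag_mx; apply/rowP => i.
  rewrite !mxE; case: eqP => _; first by rewrite rmorph1 mulr1.
  by rewrite expr2; congr (_ * _); apply: geC0_conj; apply: ltW.
- move=> i; rewrite mxE; case: eqP => _; first by rewrite ler01 lexx.
  by rewrite exprn_ge0 ?exprn_ile1 // ?ltW.
- rewrite divr_gt0 ?ltr0n // ltr_pdivrMr ?ltr0n // mul1r.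
  by rewrite (le_lt_trans r1) // ltr1n.
move=> T T0; exists a, (g ^+ #|T| * b); split => //.
- exact: tens_damp_GHZ.
- apply: le_lt_trans g2; rewrite lerMn2r normrM normrX (gtr0_norm g0).
  (* With at least one qubit, [g] bounds the damping factor uniformly in the size; [|b| <= 1] then
     bounds the second coefficient. *)
  have gT : g ^+ #|T| <= g.
    by rewrite -(prednK T0) exprS ler_piMr ?exprn_ile1 // ltW.
  by apply: le_trans gT; rewrite ler_piMr ?exprn_ge0 // ltW.
- by rewrite -rE ltcR ltr_pdivrMr ?ltr0n // ltr_pMr // ltr1n.
Qed.
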